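(* In the normal-quadratic Downsian election game with parameters $\alpha,\beta>0$ (as specified in the context), the profile of unbiased strategies, $y_i(s_i)=\mathbb{E}[\theta\mid s_i]=\frac{\beta}{\alpha+\beta}s_i$ for both $i\in\{A,B\}$, cannot be supported in an equilibrium. In particular, candidates would deviate by overreacting to their information, whereas underreacting would be worse than playing the unbiased strategy: when the voter best responds to the profile of unbiased strategies and candidate $-i$ plays the unbiased strategy, candidate $i$ with signal $s_i\neq 0$ obtains a strictly higher conditional probability of winning than from $\mathbb{E}[\theta\mid s_i]$ by choosing a platform that overreacts ($x_i>\mathbb{E}[\theta\mid s_i]$ if $s_i>0$; $x_i<\mathbb{E}[\theta\mid s_i]$ if $s_i<0$), and a strictly lower one by choosing a platform that underreacts ($x_i\in[0,\mathbb{E}[\theta\mid s_i])$ if $s_i>0$; $x_i\in(\mathbb{E}[\theta\mid s_i],0]$ if $s_i<0$).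
   Context: Normal-quadratic Downsian election game. The state is $\theta\sim\mathcal{N}(0,1/\alpha)$; conditional on $\theta$, the two candidates $A,B$ receive independent private signals $s_i\sim\mathcal{N}(\theta,1/\beta)$, $s_i\in\mathbb{R}$. Candidates simultaneously choose platforms $x_A,x_B\in\mathbb{R}$; the voter observes the platforms (not the signals), updates her belief about $\theta$, and elects a candidate $i$, whose platform $x_i$ is implemented. The voter's utility from implemented policy $x$ is $-(x-\theta)^2$. The elected candidate gets utility $1$, the other $0$. A pure strategy of candidate $i$ is a measurable $y_i:\mathbb{R}\to\mathbb{R}$ with $\mathbb{E}[(y_i(s_i)-\theta)^2]<\infty$. A voter strategy is a measurable $w_A:\mathbb{R}^2\to[0,1]$, with $w_A(x_A,x_B)$ the probability that $A$ is elected. An equilibrium is a (weak) perfect Bayesian equilibrium $(y_A,y_B,w_A)$ with pure candidate strategies: (i) for each $i$ and a.e. $s_i$, $y_i(s_i)$ maximizes $i$'s conditional winning probability given $s_i$; (ii) the voter's beliefs about $\theta$ follow Bayes' rule on path and are arbitrary off path; (iii) at every platform pair the voter elects $i$ with probability one if $x_i$ gives strictly higher expected utility than $x_{-i}$ under her belief, and may randomize arbitrarily when indifferent. Under the profile of unbiased strategies (which are injective with range $\mathbb{R}$), the voter's best response means that after each platform pair $(x_A,x_B)$ she infers signals $s_i=\frac{\alpha+\beta}{\beta}x_i$ and elects a candidate whose platform maximizes her expected utility given these signals. *)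

(* Defs.v *)
From HB Require Import structures.
From mathcomp Require Export all_boot all_order all_algebra.
From mathcomp Require Export all_classical all_reals all_analysis.
Export Order.TTheory GRing.Theory Num.Theory.
Export numFieldNormedType.Exports.

Set Implicit Arguments.
Unset Strict Implicit.
Unset Printing Implicit Defensive.

Global Open Scope classical_set_scope.
Global Open Scope ring_scope.

Variant candidate := CandA | CandB.

Definition opponent (i : candidate) : candidate :=
  match i with CandA => CandB | CandB => CandA end.

(* [normal_pdf] and [normal_prob] take a standard deviation as their second
   argument, hence the square roots of the variances 1/alpha and 1/beta. *)
Definition prior_sd (R : realType) (alpha : R) : R := Num.sqrt alpha^-1.
Definition signal_sd (R : realType) (beta : R) : R := Num.sqrt beta^-1.

(* theta ~ N(0, 1/alpha) and, conditionally on theta, the two signals are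
   independent and N(theta, 1/beta). *)
Definition normal_signals (R : realType) (d : measure_display)
    (Omega : measurableType d) (P : probability Omega R) (alpha beta : R)
    (theta : {RV P >-> R}) (s : candidate -> {RV P >-> R}) : Prop :=
  forall E FA FB : set R, measurable E -> measurable FA -> measurable FB ->
  P (theta @^-1` E `&` s CandA @^-1` FA `&` s CandB @^-1` FB) =
  (\int[normal_prob 0 (prior_sd alpha)]_(t in E)
     (normal_prob t (signal_sd beta) FA * normal_prob t (signal_sd beta) FB))%E.

(* Unnormalized posterior density of theta after observing the signals [ss]. *)
Definition state_weight (R : realType) (alpha beta : R) (ss : seq R) (t : R) : R :=
  normal_pdf 0 (prior_sd alpha) t
  * \prod_(z <- ss) normal_pdf t (signal_sd beta) z.

(* E[h(theta) | signals ss], by Bayes' formula for densities. This is the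
   version of the conditional expectation that is used at every signal
   realization, not only almost everywhere. *)
Definition cond_exp (R : realType) (alpha beta : R) (ss : seq R) (h : R -> R) : R :=
  (\int[lebesgue_measure]_t (h t * state_weight alpha beta ss t))
  / (\int[lebesgue_measure]_t state_weight alpha beta ss t).

Definition unbiased (R : realType) (alpha beta : R) (si : R) : R :=
  cond_exp alpha beta [:: si] id.

(* Probability that candidate i is elected under the voter strategy w (w x is
   the probability that A is elected at x = (x_A, x_B)), when i offers xi and
   the opponent offers xo. *)
Definition elected (R : realType) (w : R * R -> R) (i : candidate) (xi xo : R) : R :=
  match i with
  | CandA => w (xi, xo)
  | CandB => 1 - w (xo, xi)
  end.

(* Conditional winning probability of candidate i given the signal si, when i
   offers the platform xi and the opponent plays the strategy yo; the
   opponent's signal is N(theta, 1/beta) and independent of si given theta. *)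
Definition win_prob (R : realType) (alpha beta : R) (w : R * R -> R)
    (i : candidate) (yo : R -> R) (xi si : R) : R :=
  cond_exp alpha beta [:: si]
    (fun t => \int[normal_prob t (signal_sd beta)]_z elected w i xi (yo z)).

Definition voter_strategy (R : realType) (w : R * R -> R) : Prop :=
  measurable_fun [set: R * R] w /\ forall x, 0 <= w x <= 1.

(* [u xA xB x] is the voter's expected utility from policy x under the belief
   she holds after observing the platform pair (xA, xB). *)
Definition voter_optimal (R : realType) (u : R -> R -> R -> \bar R)
    (w : R * R -> R) : Prop :=
  forall xA xB : R,
    ((u xA xB xB < u xA xB xA)%E -> w (xA, xB) = 1) /\
    ((u xA xB xA < u xA xB xB)%E -> w (xA, xB) = 0).

Definition voter_utility (R : realType) (x t : R) : R := - (x - t) ^+ 2.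

Definition candidate_strategy (R : realType) (d : measure_display)
    (Omega : measurableType d) (P : probability Omega R)
    (theta si : {RV P >-> R}) (y : R -> R) : Prop :=
  measurable_fun [set: R] y /\
  (\int[P]_o ((y (si o) - theta o) ^+ 2)%:E < +oo)%E.

Definition platforms (R : realType) (d : measure_display)
    (Omega : measurableType d) (P : probability Omega R)
    (s : candidate -> {RV P >-> R}) (y : candidate -> R -> R) (o : Omega) :
    measurableTypeR R * measurableTypeR R :=
  (y CandA (s CandA o), y CandB (s CandB o)).

(* The voter's belief about theta agrees, at almost every platform pair
   generated by the strategies y, with a regular conditional distribution
   kappa of theta given the platform pair. Beliefs are unrestricted (and need
   not be measurable in the platforms) elsewhere. *)
Definition bayes_on_path (R : realType) (d : measure_display)
    (Omega : measurableType d) (P : probability Omega R)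
    (theta : {RV P >-> R}) (s : candidate -> {RV P >-> R})
    (y : candidate -> R -> R)
    (belief : R -> R -> probability (measurableTypeR R) R) : Prop :=
  exists kappa : R.-pker (measurableTypeR R * measurableTypeR R)
                   ~> measurableTypeR R,
    (forall (D : set (measurableTypeR R * measurableTypeR R)) (E : set R),
       measurable D -> measurable E ->
       P (platforms s y @^-1` D `&` theta @^-1` E) =
       (\int[P]_(o in platforms s y @^-1` D) kappa (platforms s y o) E)%E) /\
    {ae P, forall o, forall E : set R, measurable E ->
       belief (y CandA (s CandA o)) (y CandB (s CandB o)) E =
       kappa (platforms s y o) E}.

(* Weak perfect Bayesian equilibrium with pure candidate strategies. *)
Definition equilibrium (R : realType) (d : measure_display)
    (Omega : measurableType d) (P : probability Omega R) (alpha beta : R)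
    (theta : {RV P >-> R}) (s : candidate -> {RV P >-> R})
    (y : candidate -> R -> R) (w : R * R -> R) : Prop :=
  [/\ forall i, candidate_strategy theta (s i) (y i),
      voter_strategy w,
      forall i, {ae P, forall o, forall x : R,
        win_prob alpha beta w i (y (opponent i)) x (s i o) <=
        win_prob alpha beta w i (y (opponent i)) (y i (s i o)) (s i o)} &
      exists belief : R -> R -> probability (measurableTypeR R) R,
        bayes_on_path theta s y belief /\
        voter_optimal
          (fun xA xB x => \int[belief xA xB]_t (voter_utility x t)%:E)%E w].

(* The voter best responds to the profile of unbiased strategies: at (xA, xB)
   she infers the signals (alpha + beta) / beta * x_i. *)
Definition best_response_to_unbiased (R : realType) (alpha beta : R)
    (w : R * R -> R) : Prop :=
  voter_strategy w /\
  voter_optimal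
    (fun xA xB x =>
       (cond_exp alpha beta
          [:: (alpha + beta) / beta * xA; (alpha + beta) / beta * xB]
          (voter_utility x))%:E) w.

Definition overreacts (R : realType) (m si x : R) : Prop :=
  (0 < si /\ m < x) \/ (si < 0 /\ x < m).

Definition underreacts (R : realType) (m si x : R) : Prop :=
  (0 < si /\ 0 <= x < m) \/ (si < 0 /\ m < x <= 0).

(* Main.v *)
From HB Require Import structures.
Require Import Defs.
From mathcomp Require Import measurable_realfun ring lra.

(* Given the two signals, theta is normal with mean
   k (x_A + x_B), k = (alpha + beta) / (alpha + 2 beta) > 1/2, where x_i are the
   unbiased platforms. As k > 1/2, the platform of larger absolute value is
   closer to this mean, so the voter elects the more extreme candidate. Against
   an opponent who plays c s_{-i}, c = beta / (alpha + beta), the platform x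
   thus wins exactly when |s_{-i}| < |x| / c, an event whose conditional
   probability is strictly increasing in |x|.
   In an equilibrium supporting the unbiased profile the beliefs, and hence the
   election outcomes, are pinned down only at almost every pair of platforms.
   By Fubini, for almost every platform x the outcome against almost every
   platform of the opponent is as above, and such an x with |x| > |c s_A| is a
   profitable deviation for almost every s_A. *)

Set Implicit Arguments.
Unset Strict Implicit.
Unset Printing Implicit Defensive.

(** * Normal densities in precision form, and reflections of the line *)

Section gaussian_density.
Variable R : realType.
Implicit Types m p q x t z : R.
Local Notation mu := (@lebesgue_measure R).

Lemma sqrtV_neq0 p : 0 < p -> Num.sqrt p^-1 != 0.
Proof. by move=> p0; rewrite gt_eqF// sqrtr_gt0 invr_gt0. Qed.

Lemma normal_pdf_precision m p x : 0 < p ->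
  normal_pdf m (Num.sqrt p^-1) x =
  Num.sqrt (p / (pi *+ 2)) * expR (- (p / 2 * (x - m) ^+ 2)).
Proof.
move=> p0; rewrite normal_pdfE ?sqrtV_neq0//; congr (_ * _).
  rewrite /normal_peak sqr_sqrtr ?invr_ge0 ?ltW// -mulrnAr -sqrtrV; last first.
    by rewrite mulr_ge0 ?invr_ge0 ?(ltW p0)// mulrn_wge0// pi_ge0.
  by rewrite invfM invrK.
rewrite /normal_fun sqr_sqrtr ?invr_ge0 ?ltW//; congr expR.
by rewrite -mulr_natr; field; rewrite gt_eqF.
Qed.

Lemma normal_pdf_gt0 m p x : 0 < p -> 0 < normal_pdf m (Num.sqrt p^-1) x.
Proof.
move=> p0; rewrite normal_pdf_precision// mulr_gt0 ?expR_gt0//.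
by rewrite sqrtr_gt0 divr_gt0// mulrn_wgt0// pi_gt0.
Qed.

(** Completing the square in [t]: prior times likelihood is marginal times posterior. Precisions
    add, and the posterior mean is the precision-weighted average. *)
Lemma normal_pdfM m p q t z : 0 < p -> 0 < q ->
  normal_pdf m (Num.sqrt p^-1) t * normal_pdf t (Num.sqrt q^-1) z =
  normal_pdf m (Num.sqrt (p * q / (p + q))^-1) z *
  normal_pdf ((p * m + q * z) / (p + q)) (Num.sqrt (p + q)^-1) t.
Proof.
move=> p0 q0; have pq0 : 0 < p + q by exact: addr_gt0.
have pi20 : 0 < pi *+ 2 :> R by rewrite mulrn_wgt0// pi_gt0.
rewrite !normal_pdf_precision//; last by rewrite divr_gt0// mulr_gt0.
rewrite mulrACA [RHS]mulrACA -!expRD -!sqrtrM; last 2 first.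
- by rewrite !divr_ge0 ?mulr_ge0// ltW.
- by rewrite divr_ge0// ltW.
move: (pi *+ 2) pi20 => c c0.
by congr (Num.sqrt _ * expR _); field; rewrite ?gt_eqF.
Qed.

Lemma measurable_normal_pdf2 s :
  measurable_fun [set: R * R] (fun x : R * R => normal_pdf x.1 s x.2).
Proof.
(* For a zero standard deviation [normal_pdf] takes a default value, the indicator of the unit
   interval, whatever the mean. *)
have [->|s0] := eqVneq s 0.
  rewrite (_ : (fun _ => _) = \1_`[0, 1] \o snd).
    by apply: measurableT_comp => //; exact: measurable_indic.
  by apply/funext => x /=; rewrite /normal_pdf eqxx.
rewrite (_ : (fun _ => _) = normal_pdf 0 s \o (fun x : R * R => x.2 - x.1)).
  apply: measurableT_comp; first exact: measurable_normal_pdf.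
  exact: measurable_funB.
by apply/funext => x /=; rewrite !normal_pdfE//= normal_fun_center.
Qed.

Let reflect c : measurableTypeR R -> measurableTypeR R := fun x : R => c - x.

Let measurable_reflect c : measurable_fun setT (reflect c).
Proof. exact: measurable_funB. Qed.

(** The preimage of []a, b]] is [[c - b, c - a[], of the same length; uniqueness of Lebesgue measure
    does the rest. *)
Lemma lebesgue_measure_reflect c (A : set R) : measurable A ->
  pushforward mu (fun x : R => c - x : measurableTypeR R) A = mu A.
Proof.
move=> mA; apply/esym/(lebesgue_measure_unique
    (mu := measure_function_pushforward__canonical__measure_function_Measure
             mu (measurable_reflect c))) => //= _ [[a b]] _ <-.
rewrite /pushforward (_ : _ @^-1` _ = `[c - b, c - a[%classic).
  rewrite !lebesgue_measure_itv/= !lte_fin ltrD2l ltrN2.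
  by case: ifP => // _; rewrite -!EFinD; congr EFin; ring.
apply/seteqP; split => x /=; rewrite /reflect !in_itv/= => /andP[? ?];
  by apply/andP; split; lra.
Qed.

Lemma Rintegral_reflect c (f : R -> R) : mu.-integrable setT (EFin \o f) ->
  (\int[mu]_x f x = \int[mu]_x f (c - x))%R.
Proof.
move=> intf; congr fine.
have mf := measurable_int _ intf.
have intfc : mu.-integrable setT ((EFin \o f) \o reflect c).
  apply/integrableP; split.
    exact: (measurableT_comp mf (measurable_reflect c)).
  case/integrableP : intf => _; rewrite (_ : (\int[mu]_x _)%E =
    (\int[mu]_x (abse \o (EFin \o f) \o reflect c) x)%E)//.
  rewrite -(@ge0_integral_pushforward _ _ _ _ _ _ (measurable_reflect c) mu setT
    (abse \o (EFin \o f)))//.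
  - by apply: eq_measure_integral => /= A mA _; rewrite -(lebesgue_measure_reflect c).
  - exact: (measurableT_comp _ mf).
  - by move=> y _ /=.
rewrite -[RHS](@integral_pushforward _ _ _ _ _ _ (measurable_reflect c) mu setT (EFin \o f))//.
by apply: eq_measure_integral => /= A mA _; rewrite -(lebesgue_measure_reflect c).
Qed.

End gaussian_density.

(** * Integrability and moments under a normal density *)

Section gaussian_moments.
Variables (R : realType) (m p : R).
Hypothesis p0 : 0 < p.
Local Notation mu := (@lebesgue_measure R).
Local Notation pdf := (normal_pdf m (Num.sqrt p^-1)).

(** Half of the exponential decay absorbs the quadratic factor: with [u = p (t - m)^2 / 4] one has
    [u <= 1 + u <= exp u], which gives domination by a multiple of the density of precision
    [p / 2]. *)
Let integrable_centered : mu.-integrable setT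
  (EFin \o (fun t => (t - m) ^+ 2 * pdf t)).
Proof.
have p20 : 0 < p / 2 by rewrite divr_gt0.
(* The factor [4 / p] converts [u] back into the square; the quotient of square roots exchanges the
   peaks of the two densities. *)
pose C := (4 / p) * Num.sqrt (p / (pi *+ 2)) / Num.sqrt (p / 2 / (pi *+ 2)).
apply: (@le_integrable _ _ _ mu _ _ _
  (EFin \o (fun t => C * normal_pdf m (Num.sqrt (p / 2)^-1) t))) => //.
- apply/measurable_EFinP; apply: measurable_funM; last exact: measurable_normal_pdf.
  by apply: measurable_funX; exact: measurable_funB.
- move=> t _; rewrite !lee_fin ger0_norm; last first.
    by rewrite mulr_ge0 ?sqr_ge0 ?normal_pdf_ge0.
  rewrite (le_trans _ (ler_norm _))// !normal_pdf_precision//.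
  have pi20 : 0 < pi *+ 2 :> R by rewrite mulrn_wgt0// pi_gt0.
  have s0 : Num.sqrt (p / 2 / (pi *+ 2)) != 0.
    by rewrite gt_eqF// sqrtr_gt0 divr_gt0.
  rewrite /C [leRHS]mulrA divfK// mulrCA -[leRHS]mulrA [leRHS]mulrCA.
  rewrite ler_wpM2l// [leLHS]mulrC; set y := (t - m) ^+ 2.
  have y0 : 0 <= y by exact: sqr_ge0.
  have -> : - (p / 2 * y) = - (p / 2 / 2 * y) + - (p / 2 / 2 * y) by field.
  rewrite expRD -[leLHS]mulrA [leRHS]mulrC ler_wpM2l ?expR_ge0// expRN.
  rewrite -ler_pdivlMl ?invr_gt0 ?expR_gt0// invrK mulrC.
  rewrite -ler_pdivrMl ?divr_gt0// (le_trans _ (expR_ge1Dx _))//.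
  rewrite [leLHS](_ : _ = p / 2 / 2 * y); last by field; rewrite gt_eqF.
  by rewrite lerDr.
- rewrite (_ : _ \o _ = (fun t => C%:E * (normal_pdf m (Num.sqrt (p / 2)^-1) t)%:E)%E)//.
  by apply: integrableZl => //; exact: integrable_normal_pdf.
Qed.

Lemma integrable_normal_quad_le (a b : R) (h : R -> R) : 0 <= b ->
  measurable_fun setT h -> (forall t, `|h t| <= a + b * t ^+ 2) ->
  mu.-integrable setT (EFin \o (fun t => h t * pdf t)).
Proof.
move=> b0 mh hab.
apply: (@le_integrable _ _ _ mu _ _ _ (fun t => (a + b * 2 * m ^+ 2)%:E * (pdf t)%:E +
    (b * 2)%:E * ((t - m) ^+ 2 * pdf t)%:E)%E) => //.
- apply/measurable_EFinP; apply: measurable_funM => //; exact: measurable_normal_pdf.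
- move=> t _; rewrite -!EFinM -EFinD !lee_fin normrM (ger0_norm (normal_pdf_ge0 _ _ _)).
  rewrite (le_trans _ (ler_norm _))//.
  rewrite [leRHS](_ : _ = (a + b * (2 * m ^+ 2 + 2 * (t - m) ^+ 2)) * pdf t); last by ring.
  rewrite ler_wpM2r ?normal_pdf_ge0// (le_trans (hab t))// lerD2l ler_wpM2l//.
  (* [2 m^2 + 2 (t - m)^2] exceeds [t^2] by exactly [(t - 2 m)^2]. *)
  by have := sqr_ge0 (t - 2 * m); nra.
- apply: integrableD => //; apply: integrableZl => //.
  exact: integrable_normal_pdf.
Qed.

Lemma Rintegral_normal_pdf : \int[mu]_t pdf t = 1.
Proof. by rewrite /Rintegral integral_normal_pdf. Qed.

(** Reflection about [m] preserves the density and turns the integral [I] into [2 m - I]. *)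
Lemma Rintegral_normal_mean : \int[mu]_t (t * pdf t) = m.
Proof.
have int1 : mu.-integrable setT (EFin \o (fun t => t * pdf t)).
  apply: (@integrable_normal_quad_le 1 1) => // t; rewrite real_ler_norml ?num_real//.
  by apply/andP; split; nra.
have int0 : mu.-integrable setT (EFin \o (fun t => (m *+ 2) * pdf t)).
  apply: (@integrable_normal_quad_le `|m *+ 2| 0) => // t.
  by rewrite mul0r addr0.
have := Rintegral_reflect (m *+ 2) int1.
rewrite [X in _ = X -> _](_ : _ = \int[mu]_t (m *+ 2 * pdf t - t * pdf t)); last first.
  apply: eq_Rintegral => t _; rewrite -mulrBl; congr (_ * _).
  by rewrite !normal_pdf_precision//; congr (_ * expR (- (_ * _))); rewrite mulr2n; ring.
rewrite RintegralB// RintegralZl//; last exact: integrable_normal_pdf.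
rewrite Rintegral_normal_pdf; set I := (\int[mu]_x _); rewrite mulr1 mulr2n => H; lra.
Qed.

(** The second moment is left unevaluated: it does not depend on [x] and cancels when two platforms
    are compared. *)
Lemma Rintegral_voter_utility (x : R) :
  \int[mu]_t (voter_utility x t * pdf t) =
  - x ^+ 2 + 2 * x * m - \int[mu]_t (t ^+ 2 * pdf t).
Proof.
have int2 : mu.-integrable setT (EFin \o (fun t => t ^+ 2 * pdf t)).
  apply: (@integrable_normal_quad_le 0 1) => // t.
  by rewrite mul1r add0r ger0_norm ?sqr_ge0.
have int1 : mu.-integrable setT (EFin \o (fun t => t * pdf t)).
  apply: (@integrable_normal_quad_le 1 1) => // t; rewrite real_ler_norml ?num_real//.
  by apply/andP; split; nra.
have int0 : mu.-integrable setT (EFin \o pdf) by exact: integrable_normal_pdf.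
have intZ (f : R -> R) (r : R) : mu.-integrable setT (EFin \o f) ->
    mu.-integrable setT (EFin \o (fun t => r * f t)).
  move=> intf; rewrite (_ : _ \o _ = (fun t => r%:E * (f t)%:E)%E)//.
  exact: integrableZl.
rewrite (_ : (\int[mu]_t _) = \int[mu]_t
  ((- x ^+ 2 * pdf t + 2 * x * (t * pdf t)) - t ^+ 2 * pdf t)); last first.
  by apply: eq_Rintegral => t _; rewrite /voter_utility; ring.
rewrite RintegralB// ?RintegralD// ?RintegralZl//; last 3 first.
- exact: intZ.
- exact: intZ.
- rewrite (_ : _ \o _ = (fun t => (- x ^+ 2 * pdf t)%:E + (2 * x * (t * pdf t))%:E)%E)//.
  by apply: integrableD => //; exact: intZ.
by rewrite Rintegral_normal_mean Rintegral_normal_pdf mulr1.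
Qed.

End gaussian_moments.

(** * Posterior of the state and the voter's best response *)

Section posterior.
Variables (R : realType) (alpha beta : R).
Hypotheses (alpha0 : 0 < alpha) (beta0 : 0 < beta).
Local Notation mu := (@lebesgue_measure R).
Local Notation sd p := (Num.sqrt p^-1).

Let ab0 : 0 < alpha + beta. Proof. exact: addr_gt0. Qed.
Let abb0 : 0 < alpha + beta + beta. Proof. exact: addr_gt0. Qed.

Definition post_mean1 (z : R) : R := beta / (alpha + beta) * z.
(** Marginal density of one signal: this precision is the inverse of the variance
    [1 / alpha + 1 / beta]. *)
Definition signal_density1 (z : R) : R :=
  normal_pdf 0 (sd (alpha * beta / (alpha + beta))) z.

Definition post_mean2 (z : R * R) : R :=
  beta * (z.1 + z.2) / (alpha + beta + beta).
(** Joint density of the signals, factored into the marginal of the first and the predictive density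
    of the second given the first. *)
Definition signal_density2 (z : R * R) : R :=
  signal_density1 z.1 * normal_pdf (post_mean1 z.1)
    (sd ((alpha + beta) * beta / (alpha + beta + beta))) z.2.

Lemma state_weight1 z t : state_weight alpha beta [:: z] t =
  signal_density1 z * normal_pdf (post_mean1 z) (sd (alpha + beta)) t.
Proof.
rewrite /state_weight big_seq1 normal_pdfM// mulr0 add0r /post_mean1.
by rewrite (mulrAC beta z).
Qed.

(** Sequential updating: the posterior after the first signal serves as the prior for the second. *)
Lemma state_weight2 z t : state_weight alpha beta [:: z.1; z.2] t =
  signal_density2 z * normal_pdf (post_mean2 z) (sd (alpha + beta + beta)) t.
Proof.
have := state_weight1 z.1 t; rewrite /state_weight big_seq1 => E.
rewrite big_cons big_seq1 mulrA E -[LHS]mulrA normal_pdfM// /signal_density2 -[RHS]mulrA.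
suff -> : ((alpha + beta) * post_mean1 z.1 + beta * z.2) / (alpha + beta + beta) =
  post_mean2 z by [].
by rewrite /post_mean1 /post_mean2; field; rewrite !gt_eqF.
Qed.

Lemma signal_density1_gt0 z : 0 < signal_density1 z.
Proof. by rewrite normal_pdf_gt0// divr_gt0// mulr_gt0. Qed.

Lemma signal_density2_gt0 z : 0 < signal_density2 z.
Proof.
by rewrite mulr_gt0 ?signal_density1_gt0// normal_pdf_gt0// divr_gt0// mulr_gt0.
Qed.

Lemma measurable_signal_density2 : measurable_fun [set: R * R] signal_density2.
Proof.
apply: measurable_funM.
  by apply: measurableT_comp => //; exact: measurable_normal_pdf.
pose g (z : R * R) := (post_mean1 z.1, z.2).
rewrite (_ : (fun _ => _) = (fun x : R * R => normal_pdf x.1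
  (sd ((alpha + beta) * beta / (alpha + beta + beta))) x.2) \o g)//.
apply: measurableT_comp; first exact: measurable_normal_pdf2.
by apply: measurable_fun_pair => //=; exact: measurable_funM.
Qed.

(** The constant [K] cancels between numerator and denominator of Bayes' formula. *)
Lemma cond_exp_normal (ss : seq R) (K m p : R) (h : R -> R) :
  0 < K -> 0 < p ->
  (forall t, state_weight alpha beta ss t = K * normal_pdf m (sd p) t) ->
  mu.-integrable setT (EFin \o (fun t => h t * normal_pdf m (sd p) t)) ->
  cond_exp alpha beta ss h = \int[mu]_t (h t * normal_pdf m (sd p) t).
Proof.
move=> K0 p0 swE inth; rewrite /cond_exp.
under eq_Rintegral do rewrite swE mulrCA.
under [X in _ / X]eq_Rintegral do rewrite swE.
rewrite !RintegralZl//; last exact: integrable_normal_pdf.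
by rewrite Rintegral_normal_pdf mulr1 mulrC mulKf// gt_eqF.
Qed.

Lemma unbiasedE z : unbiased alpha beta z = beta / (alpha + beta) * z.
Proof.
rewrite /unbiased (cond_exp_normal (signal_density1_gt0 z) ab0 (state_weight1 z)).
  exact: Rintegral_normal_mean.
apply: (@integrable_normal_quad_le _ _ _ ab0 1 1) => // t.
by rewrite real_ler_norml ?num_real//; apply/andP; split; rewrite /=; nra.
Qed.

(** The difference of the two utilities is a positive multiple of [a^2 - b^2]. [V] stands for the
    second moment common to both. *)
Lemma extreme_closer (a b : R) (V : R) (c := beta / (alpha + beta)) :
  (- (c * b) ^+ 2 + 2 * (c * b) * post_mean2 (a, b) - V <
   - (c * a) ^+ 2 + 2 * (c * a) * post_mean2 (a, b) - V) = (`|b| < `|a|).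
Proof.
rewrite -[RHS]ltr_sqr ?nnegrE// !real_normK ?num_real// -[LHS]subr_gt0 -[RHS]subr_gt0.
(* The multiple is [c] times the excess of [2 beta / (alpha + 2 beta)] over [c]. *)
have k0 : 0 < c * (beta * alpha / ((alpha + beta) * (alpha + beta + beta))).
  by rewrite mulr_gt0 ?divr_gt0 ?mulr_gt0.
rewrite -(pmulr_rgt0 (a ^+ 2 - b ^+ 2) k0); congr (0 < _).
by rewrite /c /post_mean2 /=; field; rewrite !gt_eqF.
Qed.

Lemma cond_exp_utility2 a b x :
  cond_exp alpha beta [:: a; b] (voter_utility x) =
  - x ^+ 2 + 2 * x * post_mean2 (a, b) -
  \int[mu]_t (t ^+ 2 * normal_pdf (post_mean2 (a, b)) (sd (alpha + beta + beta)) t).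
Proof.
rewrite (cond_exp_normal (signal_density2_gt0 (a, b)) abb0 (state_weight2 (a, b))).
  exact: Rintegral_voter_utility.
apply: (@integrable_normal_quad_le _ _ _ abb0 (2 * x ^+ 2) 2) => //.
  by apply: measurableT_comp => //; apply: measurable_funX; exact: measurable_funB.
move=> t; rewrite /voter_utility normrN ger0_norm ?sqr_ge0//.
by have := sqr_ge0 (x + t); nra.
Qed.

Lemma best_response_elects (w : R * R -> R) (a b : R) (c := beta / (alpha + beta)) :
  best_response_to_unbiased alpha beta w ->
  (`|b| < `|a| -> w (c * a, c * b) = 1) /\ (`|a| < `|b| -> w (c * a, c * b) = 0).
Proof.
have cK x : (alpha + beta) / beta * (c * x) = x.
  by rewrite /c; field; rewrite !gt_eqF.
case=> _ /(_ (c * a) (c * b)); rewrite !lte_fin !cK !cond_exp_utility2.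
(* The posterior mean is symmetric in the signals, so the second comparison is the first with [a]
   and [b] exchanged. *)
rewrite extreme_closer (_ : post_mean2 (a, b) = post_mean2 (b, a)).
  by rewrite extreme_closer => -[].
by rewrite /post_mean2 /= (addrC a).
Qed.

End posterior.

(** If the integral vanished, [f] would be zero almost everywhere on [D], and [D] would be a null
    set. *)
Lemma integral_gt0 (d : measure_display) (T : measurableType d) (R : realType)
    (mu : {measure set T -> \bar R}) (D : set T) (f : T -> \bar R) :
  measurable D -> measurable_fun D f -> (forall x, D x -> (0 < f x)%E) ->
  (0 < mu D)%E -> (0 < \int[mu]_(x in D) f x)%E.
Proof.
move=> mD mf f0 muD; rewrite lt_neqAle integral_ge0 ?andbT; last first.
  by move=> x Dx; exact/ltW/f0.
apply/negP => /eqP int0; move: muD; rewrite lt_neqAle => /andP[/eqP + _]; apply.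
have /(ae_eq_integral_abs mu mD mf) [N [mN N0 DN]] :
    (\int[mu]_(x in D) `|f x| = 0)%E.
  rewrite int0; apply: eq_integral => x; rewrite inE => Dx.
  by rewrite gee0_abs// ltW// f0.
apply/esym/eqP; rewrite eq_le measure_ge0 andbT -N0 le_measure ?inE// => x Dx.
by apply: DN => /= /(_ Dx) fx0; have := f0 x Dx; rewrite fx0 ltxx.
Qed.

(** * Winning probabilities against the unbiased strategy *)

Section winning_probability.
Variable R : realType.
Local Notation mu := (@lebesgue_measure R).
Local Notation sd p := (Num.sqrt p^-1).

(** The density is jointly measurable in mean and argument, so Tonelli gives measurability of the
    partial integral in the mean. *)
Lemma measurable_normal_prob (s : R) (A : set R) : measurable A ->
  measurable_fun [set: R] (fun t => normal_prob t s A).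
Proof.
move=> mA; pose f (x : measurableTypeR R * measurableTypeR R) : \bar R :=
  (normal_pdf x.1 s x.2 * \1_A x.2)%:E.
rewrite (_ : (fun _ => _) = fubini_F mu f); last first.
  apply/funext => t; rewrite /normal_prob integral_mkcond /fubini_F.
  apply: eq_integral => z _; rewrite /f /= patchE indicE.
  by case: (z \in A); rewrite ?mulr1 ?mulr0.
apply: measurable_fun_fubini_tonelli_F.
  apply/measurable_EFinP; apply: measurable_funM; first exact: measurable_normal_pdf2.
  by apply: measurableT_comp => //; exact: measurable_indic.
by move=> x; rewrite lee_fin mulr_ge0 ?normal_pdf_ge0.
Qed.

Lemma ae_normal_prob (m s : R) (P : R -> Prop) :
  {ae mu, forall x, P x} -> {ae normal_prob m s, forall x, P x}.
Proof.
move=> [N [mN N0 PN]]; exists N; split => //.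
by have /null_content_dominatesP := @normal_prob_dominates R m s; apply.
Qed.

Lemma measurable_norm_lt (r : R) : measurable [set z : R | `|z| < r].
Proof.
rewrite (_ : [set z | _] = `]- r, r[%classic)//.
by apply/seteqP; split => z /=; rewrite in_itv/= ltr_norml.
Qed.

(** In state [t], the chance of beating an unbiased opponent with the platform that reveals a signal
    of absolute value [r]. *)
Definition prob_within (beta r t : R) : R :=
  fine (normal_prob t (sd beta) [set z : R | `|z| < r]).

Lemma measurable_prob_within beta r :
  measurable_fun [set: R] (prob_within beta r).
Proof.
apply: measurableT_comp => //; apply: measurable_normal_prob.
exact: measurable_norm_lt.
Qed.

Lemma prob_within_bound beta r t : `|prob_within beta r t| <= 1.
Proof.
rewrite ger0_norm ?fine_ge0// -lee_fin fineK ?fin_num_measure//.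
  by apply: probability_le1; exact: measurable_norm_lt.
exact: measurable_norm_lt.
Qed.

(** The larger event also contains []r1, r2[], which is disjoint from the smaller one and has
    positive normal probability. *)
Lemma prob_within_lt beta r1 r2 t : 0 < beta -> 0 <= r1 -> r1 < r2 ->
  prob_within beta r1 t < prob_within beta r2 t.
Proof.
move=> beta0 r10 r12.
have m1 := measurable_norm_lt r1; have m2 := measurable_norm_lt r2.
rewrite -lte_fin !fineK ?fin_num_measure//.
have mI : measurable `]r1, r2[ by [].
have I0 : (0 < normal_prob t (sd beta) `]r1, r2[)%E.
  apply: integral_gt0 => //.
  - apply: measurable_funTS; apply/measurable_EFinP; exact: measurable_normal_pdf.
  - by move=> x _; rewrite lte_fin normal_pdf_gt0.
  - by rewrite /= lebesgue_measure_itv/= lte_fin r12 -EFinD lte_fin subr_gt0.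
have : (normal_prob t (sd beta) ([set z : R | `|z|%R < r1]%R `|` `]r1, r2[) <=
        normal_prob t (sd beta) [set z : R | `|z|%R < r2]%R)%E.
  apply: le_measure; rewrite ?inE//; first exact: measurableU.
  move=> z /= [zr|]; first exact: lt_trans zr r12.
  by rewrite in_itv/= => /andP[? ?]; rewrite ger0_norm// (le_trans r10)// ltW.
apply: lt_le_trans; rewrite measureU//; last first.
  apply/seteqP; split => // z /= [zr]; rewrite in_itv/= => /andP[rz _].
  by have := lt_trans rz (le_lt_trans (ler_norm _) zr); rewrite ltxx.
by rewrite lteDl// fin_num_measure.
Qed.

Variables (alpha beta : R).
Hypotheses (alpha0 : 0 < alpha) (beta0 : 0 < beta).
Let ab0 : 0 < alpha + beta. Proof. exact: addr_gt0. Qed.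

(** The strict inequality in each state survives integration against the everywhere positive
    posterior density. *)
Lemma cond_exp_prob_within_lt r1 r2 si : 0 <= r1 -> r1 < r2 ->
  cond_exp alpha beta [:: si] (prob_within beta r1) <
  cond_exp alpha beta [:: si] (prob_within beta r2).
Proof.
move=> r10 r12.
have intp r : mu.-integrable setT
  (EFin \o (fun t => prob_within beta r t *
                     normal_pdf (post_mean1 alpha beta si) (sd (alpha + beta)) t)).
  apply: (@integrable_normal_quad_le _ _ _ ab0 1 0) => //.
    exact: measurable_prob_within.
  by move=> t; rewrite mul0r addr0 prob_within_bound.
rewrite !(cond_exp_normal (signal_density1_gt0 alpha0 beta0 si) ab0
  (state_weight1 alpha0 beta0 si))//.
rewrite -subr_gt0 -RintegralB// fine_gt0//; apply/andP; split; last first.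
  by rewrite ltey_eq (integrable_fin_num _ (integrableB _ (intp r2) (intp r1))).
apply: integral_gt0 => //.
- apply/measurable_EFinP; apply: measurable_funB; apply: measurable_funM;
    [exact: measurable_prob_within|exact: measurable_normal_pdf|
     exact: measurable_prob_within|exact: measurable_normal_pdf].
- move=> t _; rewrite lte_fin -mulrBl mulr_gt0 ?normal_pdf_gt0//.
  by rewrite subr_gt0 prob_within_lt.
- by rewrite -set_itvNyy /= lebesgue_measure_itv/= ltry.
Qed.

(** The outcome is required only for almost every opponent signal, because an equilibrium determines
    no more than that. *)
Lemma win_prob_within (w : R * R -> R) i x r si : voter_strategy w ->
  {ae mu, forall z, (`|z| < r -> elected w i x (beta / (alpha + beta) * z) = 1) /\
                    (r < `|z| -> elected w i x (beta / (alpha + beta) * z) = 0)} ->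
  win_prob alpha beta w i (unbiased alpha beta) x si =
  cond_exp alpha beta [:: si] (prob_within beta r).
Proof.
move=> [mw _] wE; rewrite /win_prob; congr cond_exp; apply/funext => t.
have mpos : measurable [set z : R | `|z| < r] := measurable_norm_lt r.
rewrite /Rintegral /prob_within; congr fine.
rewrite -[in RHS](setIT [set z : R | _]) -[RHS]integral_indic//.
apply: ae_eq_integral => //.
- apply/measurable_EFinP.
  have mu1 : measurable_fun [set: R] (unbiased alpha beta).
    rewrite (_ : unbiased alpha beta = (fun z => beta / (alpha + beta) * z)).
      exact: measurable_funM.
    by apply/funext => z; rewrite unbiasedE.
  case: i {wE} => /=.
    by apply: (measurableT_comp mw); exact: measurable_fun_pair.
  apply: measurable_funB => //.
  by apply: (measurableT_comp mw); exact: measurable_fun_pair.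
- by apply/measurable_EFinP; exact: measurable_indic.
apply: ae_normal_prob.
(* Ties occur only at [z = r] and [z = - r], which form a null set. *)
have ne r' : {ae mu, forall z, z != r'}.
  exists [set r']; split => //; first by rewrite lebesgue_measure_set1.
  by move=> z /= /negP; rewrite negbK => /eqP.
have F : Filter (nbhs (almost_everywhere mu)) := ae_filter_ringOfSetsType mu.
apply: (filterS3 _ _ wE (ne r) (ne (- r))) => z [w1 w0] zr zNr _ /=.
rewrite unbiasedE// indicE; congr EFin.
have [zr'|rz|zr'] := ltgtP `|z| r.
- by rewrite w1// mem_set.
- by rewrite w0// memNset//= => /(lt_trans rz); rewrite ltxx.
- by move: zr zNr; rewrite -zr'; case: (ger0P z) => _; rewrite ?opprK eqxx.
Qed.

End winning_probability.

(** * Measures given by a density *)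

Section density.
Local Open Scope ereal_scope.
Context (d : measure_display) (T : measurableType d) (R : realType).
Variables (mu : {measure set T -> \bar R}) (k : T -> R).
Hypotheses (mk : measurable_fun [set: T] k) (k0 : forall x, (0 <= k x)%R).

Let nu (A : set T) : \bar R := \int[mu]_(x in A) (k x)%:E.

Let mkE (A : set T) : measurable_fun A (EFin \o k).
Proof. exact/measurable_funTS/measurable_EFinP. Qed.

Let nu0 : nu set0 = 0. Proof. exact: integral_set0. Qed.

Let nu_ge0 A : 0 <= nu A.
Proof. by apply: integral_ge0 => x _; rewrite lee_fin. Qed.

Let nu_sigma_additive : semi_sigma_additive nu.
Proof.
move=> F mF tF mUF; rewrite /nu ge0_integral_bigcup//; last first.
  by move=> x _; rewrite lee_fin.
by apply: is_cvg_ereal_nneg_natsum_cond => n _ _; exact: nu_ge0.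
Qed.

HB.instance Definition _ := isMeasure.Build _ _ _ nu nu0 nu_ge0 nu_sigma_additive.

Lemma density_measure : exists nu' : {measure set T -> \bar R},
  forall A, nu' A = \int[mu]_(x in A) (k x)%:E.
Proof. by exists (nu : {measure set T -> \bar R}). Qed.

Import HBNNSimple.

(** Monotone convergence along simple functions [h n] reduces the claim to indicators, where it is
    [laE]. Since [la] is any measure with this density, the lemma covers both normal laws and the
    law of the signals. *)
Lemma ge0_integral_density (la : {measure set T -> \bar R}) (f : T -> \bar R) :
  (forall A, measurable A -> la A = \int[mu]_(x in A) (k x)%:E) ->
  measurable_fun [set: T] f -> (forall x, 0 <= f x) ->
  \int[la]_x f x = \int[mu]_x (f x * (k x)%:E).
Proof.
move=> laE mf f0; pose h := nnsfun_approx measurableT mf.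
have hf x : (h n x)%:E @[n --> \oo] --> f x by exact: cvg_nnsfun_approx.
have hnd x : {homo (fun n => h n x) : m n / (m <= n)%N >-> (m <= n)%R}.
  by move=> m n mn; exact/lefP/nd_nnsfun_approx.
have laC : \int[la]_x (h n x)%:E @[n --> \oo] --> \int[la]_x f x.
  rewrite [X in _ --> X](_ : _ = \int[la]_x limn (fun n => (h n x)%:E)); last first.
    by apply: eq_integral => x _; exact/esym/cvg_lim.
  apply: cvg_monotone_convergence => //.
  - by move=> n; exact/measurable_EFinP.
  - by move=> n x _; rewrite lee_fin.
  - by move=> x _ m n mn; rewrite lee_fin hnd.
have muC : \int[mu]_x ((h n x)%:E * (k x)%:E) @[n --> \oo] --> \int[mu]_x (f x * (k x)%:E).
  rewrite [X in _ --> X](_ : _ = \int[mu]_x limn (fun n => (h n x)%:E * (k x)%:E)); last first.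
    by apply: eq_integral => x _; apply/esym/cvg_lim => //; exact: cvgeZr.
  apply: cvg_monotone_convergence => //.
  - by move=> n; apply: emeasurable_funM => //; exact/measurable_EFinP.
  - by move=> n x _; rewrite mule_ge0// lee_fin.
  - by move=> x _ m n mn; rewrite lee_wpmul2r ?lee_fin// hnd.
suff laMu n : \int[la]_x (h n x)%:E = \int[mu]_x ((h n x)%:E * (k x)%:E).
  move: laC; rewrite (_ : (fun n => \int[la]_x (h n x)%:E) =
    (fun n => \int[mu]_x ((h n x)%:E * (k x)%:E))); last exact/funext.
  by move=> laC; rewrite -(cvg_lim _ laC)// -(cvg_lim _ muC).
(* The part of [h n] on its level set at [y]. It is nonnegative even for [y < 0], since that level
   set is empty. *)
pose g y x := (y * \1_(h n @^-1` [set y]) x)%R.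
have g0 y x : (0 <= g y x)%R.
  rewrite /g indicE; have [|_] := boolP (x \in _); last by rewrite mulr0.
  by rewrite inE/= mulr1 => <-.
have mg y : measurable_fun setT (EFin \o g y).
  by apply/measurable_EFinP; apply: measurable_funM.
have hE x : (h n x)%:E = \sum_(y \in range (h n)) (g y x)%:E.
  by rewrite fsumEFin// -fimfunE.
have hkE x : (h n x)%:E * (k x)%:E = \sum_(y \in range (h n)) ((g y x)%:E * (k x)%:E).
  by rewrite hE ge0_mule_fsuml// => y; rewrite lee_fin.
under eq_integral do rewrite hE.
under [RHS]eq_integral do rewrite hkE.
rewrite !ge0_integral_fsum//; last 3 first.
- by move=> y; exact: (emeasurable_funM (mg y) (@mkE setT)).
- by move=> y x _; rewrite mule_ge0// lee_fin.
- by move=> y x _; rewrite lee_fin.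
apply: eq_fsbigr => y; rewrite inE => -[x0 _ hx0].
have y0 : (0 <= y)%R by rewrite -hx0.
have mA : measurable (h n @^-1` [set y]) by [].
rewrite integralZl_indic_nnsfun// integral_indic// setIT laE//.
under [RHS]eq_integral do rewrite EFinM -muleA.
rewrite ge0_integralZl//; last 2 first.
- by apply: emeasurable_funM => //; exact/measurable_EFinP.
- by move=> x _; rewrite mule_ge0// lee_fin.
congr (_ * _); rewrite integral_mkcond; apply: eq_integral => x _.
by rewrite patchE indicE; case: ifP => _; rewrite ?mul1e ?mul0e.
Qed.

End density.

(** * Joint law of the state and the two signals *)

Section law.
Context (R : realType) (d : measure_display) (Omega : measurableType d).
Variables (P : probability Omega R) (alpha beta : R).
Variables (theta : {RV P >-> R}) (s : candidate -> {RV P >-> R}).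
Hypotheses (alpha0 : 0 < alpha) (beta0 : 0 < beta).
Hypothesis hmodel : normal_signals alpha beta theta s.
Local Notation mu := (@lebesgue_measure R).
Local Notation sd p := (Num.sqrt p^-1).
Local Notation R2 := (measurableTypeR R * measurableTypeR R)%type.


Definition posterior2 (z : R * R) : probability (measurableTypeR R) R :=
  normal_prob (post_mean2 alpha beta z) (sd (alpha + beta + beta)).

Lemma normal_probE m sg (A : set R) : measurable A ->
  normal_prob m sg A = (\int[mu]_x (\1_A x * normal_pdf m sg x)%:E)%E.
Proof.
move=> mA; rewrite /normal_prob integral_mkcond; apply: eq_integral => x _.
by rewrite patchE indicE; case: ifP => _; rewrite ?mul1r ?mul0r.
Qed.

Lemma measurable_post_mean2 : measurable_fun [set: R2] (post_mean2 alpha beta).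
Proof.
apply: measurable_funM => //; apply: measurable_funM => //.
exact: measurable_funD.
Qed.

Lemma measurable_posterior2 (E : set R) : measurable E ->
  measurable_fun [set: R2] (fun z => posterior2 z E).
Proof.
move=> mE.
apply: (measurableT_comp (measurable_normal_prob (sd (alpha + beta + beta)) mE)).
exact: measurable_post_mean2.
Qed.

(** Joint density of the state [t] and the signals [a] and [b], cut off to a box. *)
Let G E FA FB t a b : R := \1_E t * \1_FA a * \1_FB b *
  (normal_pdf 0 (sd alpha) t * (normal_pdf t (sd beta) a * normal_pdf t (sd beta) b)).

Let G_ge0 E FA FB t a b : 0 <= G E FA FB t a b.
Proof. by rewrite /G !mulr_ge0 ?normal_pdf_ge0. Qed.

Let mG E FA FB : measurable E -> measurable FA -> measurable FB ->
  measurable_fun [set: R2 * measurableTypeR R] (fun x => G E FA FB x.1.1 x.1.2 x.2).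
Proof.
move=> mE mFA mFB.
have m1 : measurable_fun [set: R2 * measurableTypeR R] (fun x => x.1.1).
  exact: measurableT_comp.
have m2 : measurable_fun [set: R2 * measurableTypeR R] (fun x => x.1.2).
  exact: measurableT_comp.
have m3 : measurable_fun [set: R2 * measurableTypeR R] (fun x => x.2) := measurable_snd.
apply: measurable_funM; first apply: measurable_funM; first apply: measurable_funM.
- by apply: (measurableT_comp _ m1); exact: measurable_indic.
- by apply: (measurableT_comp _ m2); exact: measurable_indic.
- by apply: (measurableT_comp _ m3); exact: measurable_indic.
apply: measurable_funM; last apply: measurable_funM.
- by apply: (measurableT_comp _ m1); exact: measurable_normal_pdf.
- exact: (measurableT_comp (measurable_normal_pdf2 (sd beta)) (measurable_fun_pair m1 m2)).
- exact: (measurableT_comp (measurable_normal_pdf2 (sd beta)) (measurable_fun_pair m1 m3)).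
Qed.

(** Tonelli twice: [t] is exchanged first with [a], the integral over [b] being part of the
    integrand, and then with [b] at fixed [a]. *)
Let swapG E FA FB : measurable E -> measurable FA -> measurable FB ->
  (\int[mu]_t \int[mu]_a \int[mu]_b (G E FA FB t a b)%:E =
   \int[mu]_a \int[mu]_b \int[mu]_t (G E FA FB t a b)%:E)%E.
Proof.
move=> mE mFA mFB.
pose g (x : R2 * measurableTypeR R) : \bar R := (G E FA FB x.1.1 x.1.2 x.2)%:E.
pose H (x : R2) : \bar R := (\int[mu]_b (G E FA FB x.1 x.2 b)%:E)%E.
have mH : measurable_fun [set: R2] H.
  apply: (@measurable_fun_fubini_tonelli_F _ _ R2 (measurableTypeR R) R mu g).
    by apply/measurable_EFinP; exact: mG.
  by move=> x; rewrite lee_fin.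
have H0 x : (0 <= H x)%E by apply: integral_ge0 => b _; rewrite lee_fin.
transitivity (\int[mu]_t \int[mu]_a H (t, a))%E; first by [].
transitivity (\int[mu]_a \int[mu]_t H (t, a))%E.
  exact: (@fubini_tonelli _ _ (measurableTypeR R) (measurableTypeR R) R mu mu H mH H0).
apply: eq_integral => a _.
pose h (x : R2) : \bar R := (G E FA FB x.1 a x.2)%:E.
have mh : measurable_fun [set: R2] h.
  have mp : measurable_fun [set: R2] (fun x : R2 => ((x.1, a), x.2)).
    by apply: measurable_fun_pair => //=; exact: measurable_fun_pair.
  by apply/measurable_EFinP; exact: (measurableT_comp (mG mE mFA mFB) mp).
have h0 x : (0 <= h x)%E by rewrite lee_fin.
transitivity (\int[mu]_t \int[mu]_b h (t, b))%E; first by [].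
exact: (@fubini_tonelli _ _ (measurableTypeR R) (measurableTypeR R) R mu mu h mh h0).
Qed.

Let integral_Gb E FA FB t a : measurable FB ->
  (\int[mu]_b (G E FA FB t a b)%:E =
  (\1_E t * \1_FA a * (normal_pdf 0 (sd alpha) t * normal_pdf t (sd beta) a))%:E *
  normal_prob t (sd beta) FB)%E.
Proof.
move=> mFB; rewrite normal_probE// -ge0_integralZl_EFin//.
- by apply: eq_integral => b _; rewrite -EFinM /G; congr EFin; ring.
- by move=> x _; rewrite lee_fin mulr_ge0 ?normal_pdf_ge0.
- apply/measurable_EFinP; apply: measurable_funM; first exact: measurable_indic.
  exact: measurable_normal_pdf.
- by rewrite !mulr_ge0 ?normal_pdf_ge0.
Qed.

Let integral_Gab E FA FB t : measurable FA -> measurable FB ->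
  (\int[mu]_a \int[mu]_b (G E FA FB t a b)%:E = (\1_E t)%:E *
   (normal_prob t (sd beta) FA * normal_prob t (sd beta) FB) *
   (normal_pdf 0 (sd alpha) t)%:E)%E.
Proof.
move=> mFA mFB; under eq_integral do rewrite integral_Gb//.
have fB : normal_prob t (sd beta) FB \is a fin_num by rewrite fin_num_measure.
have FB0 : 0 <= fine (normal_prob t (sd beta) FB) by rewrite fine_ge0.
rewrite -(fineK fB); set nB := fine _ in FB0 *.
rewrite [RHS](_ : _ = (\1_E t * nB * normal_pdf 0 (sd alpha) t)%:E *
    normal_prob t (sd beta) FA)%E; last first.
  have fA : normal_prob t (sd beta) FA \is a fin_num by rewrite fin_num_measure.
  by rewrite -(fineK fA) -!EFinM; congr EFin; ring.
rewrite normal_probE// -ge0_integralZl_EFin//.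
- by apply: eq_integral => a _; rewrite -!EFinM; congr EFin; ring.
- by move=> x _; rewrite lee_fin mulr_ge0 ?normal_pdf_ge0.
- apply/measurable_EFinP; apply: measurable_funM; first exact: measurable_indic.
  exact: measurable_normal_pdf.
- by rewrite !mulr_ge0 ?normal_pdf_ge0.
Qed.

(** Bayes' formula enters here: [state_weight2] splits the integrand into signal density and
    posterior density. *)
Let integral_Gt E FA FB a b : measurable E ->
  (\int[mu]_t (G E FA FB t a b)%:E = (\1_FA a * \1_FB b *
    (signal_density2 alpha beta (a, b) * fine (posterior2 (a, b) E)))%:E)%E.
Proof.
move=> mE; rewrite mulrA EFinM fineK ?fin_num_measure//.
rewrite [posterior2 _ _]normal_probE// -ge0_integralZl_EFin//.
- apply: eq_integral => t _; rewrite -!EFinM; congr EFin.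
  transitivity (\1_FA a * \1_FB b * \1_E t * state_weight alpha beta [:: a; b] t).
    by rewrite /state_weight big_cons big_seq1 /G /prior_sd /signal_sd; ring.
  by rewrite (state_weight2 alpha0 beta0 (a, b)); ring.
- by move=> x _; rewrite lee_fin mulr_ge0 ?normal_pdf_ge0.
- apply/measurable_EFinP; apply: measurable_funM; first exact: measurable_indic.
  exact: measurable_normal_pdf.
- by apply: mulr_ge0; [exact: mulr_ge0|exact/ltW/signal_density2_gt0].
Qed.

Lemma measurable_joint_density E : measurable E -> measurable_fun [set: R2]
  (fun z => signal_density2 alpha beta z * fine (posterior2 z E)).
Proof.
move=> mE; apply: measurable_funM; first exact: measurable_signal_density2.
by apply: measurableT_comp => //; exact: measurable_posterior2.
Qed.

Lemma joint_density_ge0 E z : 0 <= signal_density2 alpha beta z * fine (posterior2 z E).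
Proof. by rewrite mulr_ge0 ?fine_ge0// ltW// signal_density2_gt0. Qed.

(** The model integrates over the state last; integrating over it first makes the posterior
    appear. *)
Let law_rect E FA FB : measurable E -> measurable FA -> measurable FB ->
  P (theta @^-1` E `&` s CandA @^-1` FA `&` s CandB @^-1` FB) =
  (\int[mu \x mu]_(z in FA `*` FB)
     (signal_density2 alpha beta z * fine (posterior2 z E))%:E)%E.
Proof.
move=> mE mFA mFB; rewrite hmodel// integral_mkcond.
have mN (F : set R) : measurable F ->
    measurable_fun [set: R] (fun t => normal_prob t (sd beta) F).
  exact: measurable_normal_prob.
rewrite (ge0_integral_density (mu := mu) (measurable_normal_pdf 0 (sd alpha))
  (normal_pdf_ge0 0 (sd alpha)))//; last 2 first.
- apply/(measurable_restrictT _ _).1 => //; apply: measurable_funTS.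
  by apply: emeasurable_funM; exact: mN.
- by move=> t; rewrite erestrict_ge0// => ? _; rewrite mule_ge0.
transitivity (\int[mu]_t \int[mu]_a \int[mu]_b (G E FA FB t a b)%:E)%E.
  apply: eq_integral => t _; rewrite integral_Gab// patchE indicE; congr (_ * _)%E.
  by case: ifP => _; rewrite ?mul1e ?mul0e.
rewrite swapG// [RHS]integral_mkcond.
pose h (z : R2) : \bar R := (\1_FA z.1 * \1_FB z.2 *
  (signal_density2 alpha beta z * fine (posterior2 z E)))%:E.
rewrite [RHS](_ : _ = \int[mu \x mu]_z h z)%E; last first.
  apply: eq_integral => z _; rewrite patchE /h !indicE in_setX.
  by case: (z.1 \in FA) (z.2 \in FB) => -[]; rewrite ?mul1r ?mul0r.
have mh : measurable_fun [set: R2] h.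
  apply/measurable_EFinP; apply: measurable_funM; last exact: measurable_joint_density.
  by apply: measurable_funM; apply: measurableT_comp => //; exact: measurable_indic.
rewrite (fubini_tonelli1 h mh); last first.
  by move=> z; rewrite lee_fin mulr_ge0 ?joint_density_ge0// mulr_ge0.
apply: eq_integral => a _; apply: eq_integral => b _.
by rewrite integral_Gt.
Qed.

Definition signals (o : Omega) : R2 := (s CandA o, s CandB o).

Lemma measurable_signals : measurable_fun [set: Omega] signals.
Proof.
have ms i : measurable_fun [set: Omega] (s i : Omega -> measurableTypeR R).
  exact: (@measurable_funPT _ _ _ _ (s i)).
exact: (measurable_fun_pair (ms CandA) (ms CandB)).
Qed.

(** Rectangles are stable under intersection and generate the product sigma-algebra, so agreement on
    them extends to every [D]. *)
Lemma signals_law E D : measurable E -> measurable D ->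
  P (signals @^-1` D `&` theta @^-1` E) =
  (\int[mu \x mu]_(z in D)
     (signal_density2 alpha beta z * fine (posterior2 z E))%:E)%E.
Proof.
move=> mE mD.
have mtE : measurable (theta @^-1` E) by rewrite -[_ @^-1` _]setTI; exact: measurable_funP.
have [m2 m2E] := density_measure (mu \x mu)%E (measurable_joint_density mE)
  (joint_density_ge0 E).
(* The law of the signals restricted to the event that [theta] lies in [E]. *)
pose m1 : {measure set R2 -> \bar R} :=
  measure_function_pushforward__canonical__measure_function_Measure
    (mrestr P mtE) measurable_signals.
rewrite -m2E -[LHS]/(m1 D).
pose rect := [set C | exists2 A, measurable A & exists2 B, measurable B & A `*` B = C]
  : set (set R2).
apply: (measure_unique rect (fun=> setT)) => //.
- by rewrite measurable_prod_measurableType.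
- move=> _ _ [A1 mA1 [B1 mB1 <-]] [A2 mA2 [B2 mB2 <-]].
  exists (A1 `&` A2); first exact: measurableI.
  exists (B1 `&` B2); first exact: measurableI.
  by rewrite setXI.
- by move=> _; exists setT => //; exists setT => //; rewrite setXTT.
- by rewrite bigcup_const//; exists 0%N.
- move=> _ [A mA [B mB <-]]; rewrite m2E -law_rect//.
  rewrite /m1 /= /pushforward /mrestr; congr (P _).
  by apply/seteqP; split => o /=; [move=> [[? ?] ?]|move=> [[? ?] ?]].
- move=> _; apply: (@le_lt_trans _ _ 1%E); last exact: ltry.
  by rewrite /m1/= /pushforward /mrestr preimage_setT setTI; exact: probability_le1.
Qed.

End law.

(** Rational rays form a generating pi-system. Their countability later allows a single null set to
    serve all events [E]. *)
Lemma measure_eq_rays (R : realType)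
    (m1 m2 : {measure set (measurableTypeR R) -> \bar R}) :
  (m1 setT < +oo)%E ->
  (forall q : rat, m1 `]-oo, ratr q]%classic = m2 `]-oo, ratr q]%classic) ->
  forall E, measurable E -> m1 E = m2 E.
Proof.
move=> m1y m12; pose G : set (set (measurableTypeR R)) := range (fun q : rat => `]-oo, (ratr q : R)]%classic).
apply: (measure_unique G (fun n : nat => `]-oo, (ratr n%:R : R)]%classic)) => //.
- apply/seteqP; split; last first.
    by apply: smallest_sub => //; [exact: sigma_algebra_measurable|move=> _ [q _ <-]].
  rewrite [X in X `<=` _]RGenInftyO.measurableE.
  apply: smallest_sub; first exact: smallest_sigma_algebra.
  move=> _ [x ->].
  (* Open rays generate the Borel sets; each one is the union of the closed rational rays it
     contains. *)
  rewrite (_ : `]-oo, x[%classic = \bigcup_q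
      (if ratr q < x then `]-oo, (ratr q : R)]%classic else set0)).
    apply: (@bigcupT_measurable_rat _ (g_sigma_algebraType G)) => q.
    by case: ifP => // _; apply: sub_sigma_algebra; exists q.
  apply/seteqP; split => y /=; rewrite in_itv/=.
    move=> /rat_in_itvoo[q]; rewrite in_itv/= => /andP[yq qx].
    by exists q => //; rewrite qx /= in_itv/= ltW.
  by case=> q _; case: ifP => //= qx; rewrite in_itv/= => /le_lt_trans; apply.
- move=> _ _ [q1 _ <-] [q2 _ <-]; exists (Num.min q1 q2) => //.
  apply/seteqP; split => y /=; rewrite !in_itv/=.
    by rewrite /Num.min; case: ifPn => q12; rewrite -?leNgt in q12 *;
      [move=> yq; split => //; rewrite (le_trans yq)// ler_rat ltW|
       move=> yq; split => //; rewrite (le_trans yq)// ler_rat].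
  by case=> y1 y2; rewrite /Num.min; case: ifP.
- by move=> n; exists n%:R.
- apply/seteqP; split => // y _; exists (Num.bound `|y|) => //=.
  rewrite in_itv/= ratr_nat; apply: (le_trans (ler_norm y)).
  by apply/ltW/archi_boundP.
- by move=> _ [q _ <-]; exact: m12.
- by move=> n; apply: le_lt_trans m1y; rewrite le_measure ?inE.
Qed.

(** * Identification of the beliefs on the path of play *)

Section kernel_identification.
Context (R : realType) (d : measure_display) (Omega : measurableType d).
Variables (P : probability Omega R) (alpha beta : R).
Variables (theta : {RV P >-> R}) (s : candidate -> {RV P >-> R}).
Hypotheses (alpha0 : 0 < alpha) (beta0 : 0 < beta).
Hypothesis hmodel : normal_signals alpha beta theta s.
Local Notation mu := (@lebesgue_measure R).
Local Notation R2 := (measurableTypeR R * measurableTypeR R)%type.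
Local Notation K := (signal_density2 alpha beta).
Local Notation post := (posterior2 alpha beta).
Local Notation S := (signals s).

Lemma signals_density D : measurable D ->
  P (S @^-1` D) = (\int[mu \x mu]_(z in D) (K z)%:E)%E.
Proof.
move=> mD; have := signals_law alpha0 beta0 hmodel measurableT mD.
rewrite preimage_setT setIT => ->; apply: eq_integral => z _.
by rewrite probability_setT mulr1.
Qed.

Variable k : R2 -> {measure set (measurableTypeR R) -> \bar R}.
Hypothesis k1 : forall z, k z setT = 1%E.
Hypothesis mk : forall E, measurable E -> measurable_fun [set: R2] (fun z => k z E).
Hypothesis kE : forall D E, measurable D -> measurable E ->
  P (S @^-1` D `&` theta @^-1` E) = (\int[P]_(o in S @^-1` D) k (S o) E)%E.

(** Over every event about the signals, both sides integrate to the probability that it occurs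
    together with [theta] in [E]. The resulting null set depends on [E]. *)
Let kernel_posterior_set E : measurable E -> {ae P, forall o, k (S o) E = post (S o) E}.
Proof.
move=> mE.
pose nu : {measure set R2 -> \bar R} :=
  measure_function_pushforward__canonical__measure_function_Measure
    P (measurable_signals s).
have nuE D : measurable D -> nu D = (\int[mu \x mu]_(z in D) (K z)%:E)%E.
  exact: signals_density.
have mp := measurable_posterior2 alpha beta mE.
have : ae_eq nu setT (fun z => k z E) (fun z => post z E).
  apply: integral_ae_eq => //.
  - apply/integrableP; split; first exact: mk.
    apply: (@le_lt_trans _ _ (\int[nu]_(x in setT) (cst 1%E x))%E).
      apply: ge0_le_integral => //.
      + by apply: measurableT_comp => //; exact: mk.
      + by move=> z _; rewrite gee0_abs// -(k1 z) le_measure ?inE.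
    by rewrite integral_cst// mul1e /nu/= /pushforward preimage_setT probability_setT ltry.
  - move=> D _ mD; transitivity (\int[P]_(o in S @^-1` D) k (S o) E)%E.
      apply: ge0_integral_pushforward => //; first exact: measurable_signals.
      by apply: measurable_funTS; exact: mk.
    rewrite -kE// (signals_law alpha0 beta0 hmodel)//.
    rewrite [RHS]integral_mkcond (ge0_integral_density (mu := (mu \x mu)%E)
      (measurable_signal_density2 alpha beta)
      (fun z => ltW (signal_density2_gt0 alpha0 beta0 z)) nuE); last 2 first.
    + by apply/(measurable_restrictT _ _).1 => //; exact: measurable_funTS.
    + by move=> z; rewrite erestrict_ge0.
    rewrite [LHS]integral_mkcond; apply: eq_integral => z _.
    rewrite !patchE; case: ifP => _; last by rewrite mul0e.
    by rewrite EFinM fineK ?fin_num_measure// muleC.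
move=> [N [mN N0 NP]]; exists (S @^-1` N); split => //.
  by rewrite -[_ @^-1` _]setTI; exact: measurable_signals.
by move=> o /= ko; apply: NP => /= /(_ I).
Qed.

Lemma kernel_posterior : {ae P, forall o, forall E, measurable E ->
  k (S o) E = post (S o) E}.
Proof.
(* The rationals are enumerated by [unpickle], so that countably many null sets, one for each ray,
   can be merged. *)
have H (n : nat) : {ae P, forall o, forall q : rat, unpickle n = Some q ->
    k (S o) `]-oo, ratr q]%classic = post (S o) `]-oo, ratr q]%classic}.
  case: (unpickle n) => [q|]; last by apply: aeW.
  have := kernel_posterior_set (E := `]-oo, (ratr q : R)]%classic).
  case=> // N [mN N0 NP]; exists N; split => // o /= ko; apply: NP => /= E.
  by apply: ko => _ [<-].
have [N [mN N0 NP]] := ae_foralln H; exists N; split => // o /= ko; apply: NP => /= E.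
apply: ko; apply: measure_eq_rays => [|q]; first by rewrite k1 ltry.
apply: (E (pickle q)).
by rewrite pickleK.
Qed.

End kernel_identification.

Lemma integral_voter_utility (R : realType) (m p x : R) : 0 < p ->
  (\int[normal_prob m (Num.sqrt p^-1)]_t (voter_utility x t)%:E =
  (- x ^+ 2 + 2 * x * m -
   \int[lebesgue_measure]_t (t ^+ 2 * normal_pdf m (Num.sqrt p^-1) t))%:E)%E.
Proof.
move=> p0; have mq : measurable_fun [set: R] (fun t => (x - t) ^+ 2).
  by apply: measurable_funX; exact: measurable_funB.
have intq : lebesgue_measure.-integrable setT
    (EFin \o (fun t => (x - t) ^+ 2 * normal_pdf m (Num.sqrt p^-1) t)).
  apply: (@integrable_normal_quad_le _ _ _ p0 (2 * x ^+ 2) 2) => // t.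
  by rewrite ger0_norm ?sqr_ge0//; have := sqr_ge0 (x + t); nra.
rewrite -Rintegral_voter_utility// /voter_utility.
under eq_integral do rewrite EFinN.
(* The density formula concerns nonnegative integrands, so the sign is taken out first. *)
rewrite integral_ge0N; last by move=> t _; rewrite lee_fin sqr_ge0.
rewrite (ge0_integral_density (mu := lebesgue_measure) (measurable_normal_pdf m (Num.sqrt p^-1))
  (normal_pdf_ge0 m (Num.sqrt p^-1)))//; last 2 first.
- exact/measurable_EFinP.
- by move=> t; rewrite lee_fin sqr_ge0.
rewrite [RHS](_ : _ = (\int[lebesgue_measure]_t
    (-1 * ((x - t) ^+ 2 * normal_pdf m (Num.sqrt p^-1) t)))%:E); last first.
  by congr EFin; apply: eq_Rintegral => t _; rewrite mulN1r mulNr.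
rewrite RintegralZl// mulN1r EFinN; congr (- _)%E.
by rewrite /Rintegral fineK//; exact: (integrable_fin_num _ intq).
Qed.

(** * Impossibility of an unbiased equilibrium *)

Section equilibrium_elections.
Context (R : realType) (d : measure_display) (Omega : measurableType d).
Variables (P : probability Omega R) (alpha beta : R).
Variables (theta : {RV P >-> R}) (s : candidate -> {RV P >-> R}).
Hypotheses (alpha0 : 0 < alpha) (beta0 : 0 < beta).
Hypothesis hmodel : normal_signals alpha beta theta s.
Local Notation mu := (@lebesgue_measure R).
Local Notation R2 := (measurableTypeR R * measurableTypeR R)%type.
Local Notation c := (beta / (alpha + beta)).

(** Expressed in signals instead of platforms, and silent at ties, where the voter may randomize. *)
Definition elects_extreme (w : R * R -> R) (z : R * R) : Prop :=
  (`|z.2| < `|z.1| -> w (c * z.1, c * z.2) = 1) /\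
  (`|z.1| < `|z.2| -> w (c * z.1, c * z.2) = 0).

Let c0 : c != 0. Proof. by rewrite gt_eqF// divr_gt0// addr_gt0. Qed.

(** Scaling by [c] is invertible, so a conditional law given the platforms is one given the signals.
    It is therefore the normal posterior almost surely, and [extreme_closer] applies. *)
Lemma equilibrium_elects_extreme (w : R * R -> R) :
  equilibrium alpha beta theta s (fun=> unbiased alpha beta) w ->
  {ae P, forall o, elects_extreme w (signals s o)}.
Proof.
case=> _ _ _ [belief [[kappa [kappaE beliefE]] opt]].
have plE o : platforms s (fun=> unbiased alpha beta) o =
    (c * (signals s o).1, c * (signals s o).2) by rewrite /platforms !unbiasedE.
pose k (z : R2) := kappa (c * z.1, c * z.2).
have k1 z : k z setT = 1%E by exact: prob_kernel.
have mscale : measurable_fun [set: R2] (fun z : R2 => (c * z.1, c * z.2) : R2).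
  by apply: measurable_fun_pair; exact: measurable_funM.
have mk E : measurable E -> measurable_fun [set: R2] (fun z => k z E).
  by move=> mE; exact: (measurableT_comp (measurable_kernel kappa E mE) mscale).
have kE D E : measurable D -> measurable E ->
    P (signals s @^-1` D `&` theta @^-1` E) =
    (\int[P]_(o in signals s @^-1` D) k (signals s o) E)%E.
  (* The image of [D] under scaling by [c], written as a preimage under the inverse scaling to
     obtain its measurability. *)
  move=> mD mE; pose D' : set R2 := (fun x : R2 => (c^-1 * x.1, c^-1 * x.2)) @^-1` D.
  have mD' : measurable D'.
    rewrite -[D']setTI; apply: (_ : measurable_fun [set: R2]
      (fun x : R2 => (c^-1 * x.1, c^-1 * x.2) : R2)) => //.
    by apply: measurable_fun_pair; exact: measurable_funM.
  have D'E : platforms s (fun=> unbiased alpha beta) @^-1` D' = signals s @^-1` D.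
    apply/seteqP; split => o /=; rewrite plE /D' /= !mulKf//.
  have := kappaE D' E mD' mE; rewrite D'E => ->.
  by apply: eq_integral => o _; rewrite plE.
have F : Filter (nbhs (almost_everywhere P)) := ae_filter_ringOfSetsType P.
apply: (filterS2 _ _ (kernel_posterior alpha0 beta0 hmodel k1 mk kE) beliefE) => o kP bP.
have uE x : (\int[belief (c * s CandA o)%R (c * s CandB o)%R]_t (voter_utility x t)%:E =
   \int[posterior2 alpha beta (signals s o)]_t (voter_utility x t)%:E)%E.
  apply: eq_measure_integral => E mE _.
  transitivity (k (signals s o) E); last exact: kP.
  by rewrite /k -plE -bP// !unbiasedE.
have := opt (c * s CandA o) (c * s CandB o); rewrite !uE !integral_voter_utility ?addr_gt0//.
rewrite !lte_fin /elects_extreme /= extreme_closer//.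
rewrite (_ : post_mean2 alpha beta (signals s o) =
  post_mean2 alpha beta (s CandB o, s CandA o)); last first.
  by rewrite /post_mean2 /= addrC.
by rewrite extreme_closer// => -[].
Qed.

Lemma measurable_elects_extreme w : measurable_fun [set: R * R] w ->
  measurable ([set z | elects_extreme w z] : set R2).
Proof.
move=> mw.
have mscale : measurable_fun [set: R2] (fun z : R2 => (c * z.1, c * z.2) : R2).
  by apply: measurable_fun_pair; exact: measurable_funM.
have mwc r : measurable ([set z | w (c * z.1, c * z.2) = r] : set R2).
  have mc : measurable_fun [set: R2] (w \o (fun z : R2 => (c * z.1, c * z.2))).
    exact: measurableT_comp.
  by have := mc measurableT _ (measurable_set1 r); rewrite setTI.
have mlt (f g : R2 -> R) : measurable_fun [set: R2] f -> measurable_fun [set: R2] g ->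
    measurable ([set z | `|f z| < `|g z|] : set R2).
  move=> mf mg; have : measurable_fun [set: R2] (fun z => `|f z| < `|g z|).
    by apply: measurable_fun_ltr; exact: measurableT_comp.
  by move=> /(_ measurableT [set true] I); rewrite setTI.
rewrite (_ : [set z | _] =
  (~` [set z : R2 | `|z.2| < `|z.1|] `|` [set z : R2 | w (c * z.1, c * z.2) = 1]) `&`
  (~` [set z : R2 | `|z.1| < `|z.2|] `|` [set z : R2 | w (c * z.1, c * z.2) = 0])).
  by apply: measurableI; apply: measurableU => //; apply: measurableC; exact: mlt.
apply/seteqP; split => z [].
  by move=> h1 h2; split;
    [have [/h1|/negP] := boolP (`|z.2| < `|z.1|)|have [/h2|/negP] := boolP (`|z.1| < `|z.2|)];
    by [left|right].
by move=> [n1|h1] [n2|h2]; split.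
Qed.

(** The joint signal density is positive, so a set of signal pairs of probability zero is null for
    planar Lebesgue measure; by Tonelli almost all its sections are null. *)
Lemma elects_extreme_slices w : measurable_fun [set: R * R] w ->
  {ae P, forall o, elects_extreme w (signals s o)} ->
  {ae mu, forall a, {ae mu, forall b, elects_extreme w (a, b)}}.
Proof.
move=> mw [N [mN N0 NP]]; pose B : set R2 := ~` [set z | elects_extreme w z].
have mB : measurable B by apply: measurableC; exact: measurable_elects_extreme.
have PB : P (signals s @^-1` B) = 0%E.
  apply: (subset_measure0 _ mN _ N0); last by move=> o; exact: NP.
  by rewrite -[_ @^-1` _]setTI; exact: measurable_signals.
have B0 : (mu \x mu)%E B = 0%E.
  apply/eqP; rewrite eq_le measure_ge0 andbT leNgt; apply/negP => B0.
  have : (0 < \int[mu \x mu]_(z in B) (signal_density2 alpha beta z)%:E)%E.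
    apply: integral_gt0 => //.
      by apply/measurable_funTS/measurable_EFinP; exact: measurable_signal_density2.
    by move=> z _; rewrite lte_fin signal_density2_gt0.
  by rewrite -(signals_density alpha0 beta0 hmodel mB) PB ltxx.
have /(ae_eq_integral_abs mu measurableT) [|M [mM M0 MP]] :
    (\int[mu]_a `|mu (xsection B a)| = 0)%E.
- by rewrite -[RHS]B0; apply: eq_integral => a _; rewrite gee0_abs.
- exact: measurable_fun_xsection.
exists M; split => // a /= Ha; apply: MP => /= H; apply: Ha.
exists (xsection B a); split; [exact: measurable_xsection|exact: H|].
by move=> b /= Hb; rewrite /xsection /= inE.
Qed.

(** In every state the signal has an absolutely continuous law. *)
Lemma null_signal (N : set R) : measurable N -> mu N = 0%E ->
  P (s CandA @^-1` N) = 0%E.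
Proof.
move=> mN N0; have := hmodel measurableT mN measurableT.
rewrite !preimage_setT setTI setIT => ->; apply: integral0_eq => t _.
have /null_content_dominatesP := @normal_prob_dominates R t (signal_sd beta).
by move=> /(_ N mN N0) ->; rewrite mul0e.
Qed.

Lemma unbiased_not_equilibrium (w : R * R -> R) :
  ~ equilibrium alpha beta theta s (fun=> unbiased alpha beta) w.
Proof.
move=> eqw; have [_ [mw w01] best _] := eqw.
have [M [mM M0 MP]] := elects_extreme_slices mw (equilibrium_elects_extreme eqw).
have [N [mN N0 NP]] := best CandA.
have msM : measurable (s CandA @^-1` M).
  by rewrite -[_ @^-1` _]setTI; exact: (@measurable_funPT _ _ _ _ (s CandA)).
have PMN : P ((s CandA @^-1` M) `|` N) = 0%E.
  by rewrite measureU0//; exact: null_signal.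
(* An outcome outside both null sets: the signal [a] has a well-behaved section, and optimality of
   candidate A holds at [om]. *)
have [om [oM oN]] : exists o, ~ M (s CandA o) /\ ~ N o.
  apply: contrapT => /forallNP no; have : P setT = 0%E.
    apply: (subset_measure0 _ _ _ PMN) => //; first exact: measurableU.
    by move=> o _; have /not_andP[/contrapT|/contrapT] := no o; [left|right].
  by rewrite probability_setT => /eqP; rewrite onee_eq0.
pose a := s CandA om.
have good x : ~ M x -> {ae mu, forall b, elects_extreme w (x, b)} := contra_notP (MP x).
have winE x : ~ M x -> win_prob alpha beta w CandA (unbiased alpha beta) (c * x) a =
    cond_exp alpha beta [:: a] (prob_within beta `|x|).
  move=> /good wx; apply: win_prob_within => //.
(* The interval []|a|, |a| + 1[] has measure one, so it is not covered by the null set [M]. The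
   profitable deviation is then [c * x]. *)
have [x [xa xM]] : exists x, `|a| < x /\ ~ M x.
  apply: contrapT => /forallNP no; have : mu `]`|a|, `|a| + 1[%classic = 0%E.
    apply: (subset_measure0 _ _ _ M0) => // x /=; rewrite in_itv/= => /andP[ax _].
    by have /not_andP[//|/contrapT] := no x.
  rewrite lebesgue_measure_itv/= lte_fin ltrDl ltr01 -EFinB addrAC subrr add0r.
  by move=> /eqP; rewrite onee_eq0.
have := contra_notP (NP om) oN (c * x); rewrite unbiasedE// !winE//.
by rewrite leNgt cond_exp_prob_within_lt// (lt_le_trans xa)// ler_norm.
Qed.

End equilibrium_elections.

(** The voter reads the platform [x] as the signal [x / c], and the candidate wins against all
    opponent signals of smaller absolute value. *)
Lemma win_prob_best_response (R : realType) (alpha beta : R) (w : R * R -> R)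
    (i : candidate) (x si : R) (c := beta / (alpha + beta)) :
  0 < alpha -> 0 < beta -> best_response_to_unbiased alpha beta w ->
  win_prob alpha beta w i (unbiased alpha beta) x si =
  cond_exp alpha beta [:: si] (prob_within beta (`|x| / c)).
Proof.
move=> alpha0 beta0 br.
have c0 : 0 < c by rewrite divr_gt0// addr_gt0.
have -> : `|x| / c = `|x / c| by rewrite normrM normfV (gtr0_norm c0).
have xE : x = c * (x / c) by rewrite mulrC divfK// gt_eqF.
rewrite {1}xE; apply: win_prob_within => //; first by case: br.
apply: aeW => z; case: i => /=.
  exact: best_response_elects br.
(* Candidate B wins with probability [1 - w], the opponent's platform coming first, so the two
   outcomes exchange roles. *)
have [w1 w0] := best_response_elects alpha0 beta0 z (x / c) br.
by split=> h; [rewrite w0// subr0|rewrite w1// subrr].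
Qed.

Theorem proposition5 (R : realType) (d : measure_display)
    (Omega : measurableType d) (P : probability Omega R) (alpha beta : R)
    (theta : {RV P >-> R}) (s : candidate -> {RV P >-> R})
    (halpha : 0 < alpha) (hbeta : 0 < beta)
    (hmodel : normal_signals alpha beta theta s) :
  [/\ forall si : R, unbiased alpha beta si = beta / (alpha + beta) * si,
      ~ (exists w : R * R -> R,
           equilibrium alpha beta theta s (fun=> unbiased alpha beta) w) &
      forall w : R * R -> R, best_response_to_unbiased alpha beta w ->
      forall (i : candidate) (si x : R),
        (overreacts (unbiased alpha beta si) si x ->
           win_prob alpha beta w i (unbiased alpha beta)
             (unbiased alpha beta si) si <
           win_prob alpha beta w i (unbiased alpha beta) x si) /\
        (underreacts (unbiased alpha beta si) si x ->
           win_prob alpha beta w i (unbiased alpha beta) x si <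
           win_prob alpha beta w i (unbiased alpha beta)
             (unbiased alpha beta si) si)].
Proof.
(* Only the absolute value of the platform matters: overreacting raises it above that of the
   unbiased platform, underreacting lowers it. *)
have win_lt w i si x1 x2 : best_response_to_unbiased alpha beta w -> `|x1| < `|x2| ->
    win_prob alpha beta w i (unbiased alpha beta) x1 si <
    win_prob alpha beta w i (unbiased alpha beta) x2 si.
  move=> br x12; rewrite !win_prob_best_response//.
  have c0 : 0 < beta / (alpha + beta) by rewrite divr_gt0// addr_gt0.
  apply: cond_exp_prob_within_lt => //; first by rewrite divr_ge0// ltW.
  by rewrite ltr_pM2r// invr_gt0.
split.
- by move=> si; exact: unbiasedE.
- by case=> w; exact: unbiased_not_equilibrium.
move=> w br i si x; set m := unbiased alpha beta si.
have c0 : 0 < beta / (alpha + beta) by rewrite divr_gt0// addr_gt0.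
have mE : m = beta / (alpha + beta) * si by exact: unbiasedE.
have m_gt0 : 0 < si -> 0 < m by move=> si0; rewrite mE mulr_gt0.
have m_lt0 : si < 0 -> m < 0 by move=> si0; rewrite mE pmulr_rlt0.
split=> -[[si0 mx]|[si0 mx]]; apply: win_lt => //.
- by rewrite (gtr0_norm (m_gt0 si0)) (lt_le_trans mx)// ler_norm.
- rewrite (ltr0_norm (m_lt0 si0)) (@lt_le_trans _ _ (- x))// ?ltrN2//.
  by rewrite -normrN ler_norm.
- by case/andP: mx => x0 xm; rewrite ger0_norm// (lt_le_trans xm)// ler_norm.
- case/andP: mx => mx x0; rewrite ler0_norm// (@lt_le_trans _ _ (- m))// ?ltrN2//.
  by rewrite -normrN ler_norm.
Qed.
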